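(* Let $(X,\Xi,\mu)$ be a $\sigma$-finite measure space, let $\vartheta:\mathbb{R}_+\to\mathbb{R}_+$ be a ccc function, and let $(\varphi,\psi)$ be a minimal convex-concave factorization of $\vartheta$. Then $L^\vartheta(X,\mu)$ is a complete metric space with the metric $$d_\vartheta(f,g)=\inf\left\{t\in(0,\infty):\ \int_X \varphi\left(\frac1t\psi(|f-g|)\right)\,d\mu\le 1\right\}.$$
   Context: $\mathbb{R}_+=[0,\infty)$. Throughout, $\vartheta:\mathbb{R}_+\to\mathbb{R}_+$ is strictly increasing and continuous with $\vartheta(0)=0$. $\vartheta$ is called a ccc function (convex-concave composition) iff there exist two strictly increasing continuous functions $\varphi,\psi:\mathbb{R}_+\to\mathbb{R}_+$ with $\varphi(0)=\psi(0)=0$ such that $\varphi$ is convex, $\psi$ is concave and $\vartheta=\varphi\circ\psi$. Such a pair $(\varphi,\psi)$ is called a convex-concave factorization of $\vartheta$. It is called minimal if for any other factorization $(\tilde\varphi,\tilde\psi)$ of $\vartheta$ the function $\varphi^{-1}\circ\tilde\varphi$ is convex. $L^\vartheta(X,\mu)$ denotes the space of all measurable functions $f:X\to\mathbb{R}$ such that $\int_X\varphi\left(\frac1t\psi(|f|)\right)d\mu<\infty$ for some $t\in(0,\infty)$, where functions which agree $\mu$-almost everywhere are identified. *)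

(* Defs.v *)
From HB Require Import structures.
From mathcomp Require Import all_boot all_order all_algebra.
From mathcomp Require Import all_classical all_reals all_analysis.

Set Implicit Arguments.
Unset Strict Implicit.
Unset Printing Implicit Defensive.

Import Order.TTheory GRing.Theory Num.Theory.
Import numFieldNormedType.Exports.

Local Open Scope classical_set_scope.
Local Open Scope ring_scope.

(* A function R_+ -> R_+ is represented by a total function R -> R of which
   only the values on [0, +oo[ matter. *)
Definition Rplus (R : realType) : set R := `[0, +oo[.
Arguments Rplus {R}.

(* Nonnegativity on [0, +oo[ follows from f 0 = 0 and strict monotonicity. *)
Definition incr_cont0 (R : realType) (f : R -> R) : Prop :=
  [/\ f 0 = 0,
      {in Rplus &, {homo f : x y / x < y}} &
      {within Rplus, continuous f}].

Definition convex_on_Rplus (R : realType) (f : R -> R) : Prop :=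
  @convex_function R R^o Rplus f.

Definition concave_on_Rplus (R : realType) (f : R -> R) : Prop :=
  @convex_function R R^o Rplus (fun x => - f x).

Definition convex_concave_fact (R : realType) (theta phi psi : R -> R) : Prop :=
  [/\ incr_cont0 phi, incr_cont0 psi,
      convex_on_Rplus phi, concave_on_Rplus psi &
      {in Rplus, theta =1 phi \o psi}].

Definition ccc_function (R : realType) (theta : R -> R) : Prop :=
  exists phi psi : R -> R, convex_concave_fact theta phi psi.

(* [pinv Rplus phi] is the inverse of phi : R_+ -> R_+, which is a bijection
   because phi is convex and strictly increasing. *)
Definition minimal_convex_concave_fact (R : realType)
    (theta phi psi : R -> R) : Prop :=
  convex_concave_fact theta phi psi /\
  forall phi' psi' : R -> R, convex_concave_fact theta phi' psi' ->
    convex_on_Rplus (pinv Rplus phi \o phi').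

Section Ltheta.
Context d (X : measurableType d) (R : realType).
Variables (mu : {measure set X -> \bar R}) (phi psi : R -> R).

Definition modular (t : R) (h : X -> R) : \bar R :=
  (\int[mu]_x (phi (t^-1 * psi `|h x|)%R)%:E)%E.

(* Elements of {mfun_ mu, X >-> R} are classes of measurable functions modulo
   mu-a.e. equality; they coerce to functions through a representative, on
   whose choice [modular] does not depend. *)
Definition Ltheta : set {mfun_ mu, X >-> measurableTypeR R} :=
  [set f | exists2 t : R, 0 < t & (modular t f < +oo)%E].

(* The infimum is taken in the extended reals, so that it is +oo, and not the
   junk value 0, when no t is admissible. *)
Definition dtheta (f g : {mfun_ mu, X >-> measurableTypeR R}) : \bar R :=
  ereal_inf [set t%:E | t in
    [set t : R |
      0 < t /\ (modular t (fun x => (f x : R) - (g x : R))%R <= 1)%E]].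

End Ltheta.
Arguments modular {d X R} mu phi psi t h.
Arguments Ltheta {d X R} mu phi psi.
Arguments dtheta {d X R} mu phi psi f g.

(* Completeness is written as in the mixin Uniform_isComplete, which is not
   used because it bundles a pointed structure. *)
Definition complete_metric (R : realType) (M : metricType R) : Prop :=
  forall F : set_system M, ProperFilter F -> cauchy F -> exists x : M, F --> x.

Definition is_complete_metric_space (R : realType) (L : Type)
    (d : L -> L -> \bar R) : Prop :=
  exists c : Metric R L, let M := Metric.Pack c in
    (forall x y : M, d x y = (mdist x y)%:E) /\ complete_metric M.

(* Main.v *)
Require Import Defs.
From HB Require Import structures.
From mathcomp Require Import all_boot all_order all_algebra.
From mathcomp Require Import all_classical all_reals all_analysis.
From mathcomp Require Import measurable_realfun.
From mathcomp Require Import ring lra.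

(** The distance from f to g is the Luxemburg norm, attached to the convex
    function phi, of psi (|f - g|).  Two features of the factorization make
    it a metric.

    Concavity makes psi subadditive, so psi (|f + g|) <= psi |f| + psi |g|,
    and the convexity of phi then gives, for the modular
    M t h = int phi (psi |h| / t),
      M (s + t) (f + g) <= s / (s + t) * M s f + t / (s + t) * M t g
    ([modular_triangle]).  Hence the modulars at most 1 at s and t add up,
    which is the triangle inequality.  Convexity and phi 0 = 0 also give
    M t h <= s / t * M s h for s <= t ([modular_scale]): a finite modular can
    be made at most 1 by enlarging t, so L^theta is exactly the set of classes
    of finite Luxemburg norm, and a vanishing distance forces M 1 (f - g) = 0,
    that is f = g almost everywhere.

    Completeness is the argument of Riesz and Fischer.  If the distances of a
    sequence u_n to its later terms are below 4^-(n+1), then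
    M 2^-(n+1) (u_n - u_(n+1)) <= 2^-(n+1), so the sum over n of the integrands
    is integrable and finite almost everywhere.  Since phi grows at least
    linearly at infinity, this bounds psi |u_n x - u_(n+1) x| by a constant
    times 2^-(n+1), and u_n x is Cauchy because psi is subadditive and strictly
    increasing ([modular_cvg_ae]).  Fatou's lemma, with the continuity of phi
    and psi, carries the estimates on u_n - u_m over to u_n - lim u
    ([modular_fatou]).  A Cauchy filter is reduced to such a sequence by picking
    the centers of small balls that belong to it
    ([complete_metric_of_dist]). *)

Set Implicit Arguments.
Unset Strict Implicit.
Unset Printing Implicit Defensive.

Import Order.TTheory GRing.Theory Num.Theory.
Import numFieldNormedType.Exports.

Local Open Scope classical_set_scope.
Local Open Scope ring_scope.

(** * Convex and concave increasing functions on the half-line *)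

Section halfline_functions.
Context {R : realType}.
Implicit Types (f phi psi : R -> R) (x y a b t u v : R).

Lemma in_Rplus x : (x \in (Rplus : set R)) = (0 <= x).
Proof.
by apply/idP/idP; rewrite inE /Rplus /= in_itv /= andbT.
Qed.

Lemma incr_cont0_mono f : incr_cont0 f ->
  {in Num.nneg &, {mono f : x y / x <= y}}.
Proof.
move=> [_ fi _]; apply: le_mono_in => x y x0 y0.
by apply: fi; rewrite in_Rplus.
Qed.

Lemma incr_cont0_ge0 f x : incr_cont0 f -> 0 <= x -> 0 <= f x.
Proof.
by move=> fi x0; case: (fi) => f0 _ _; rewrite -f0 (incr_cont0_mono fi) ?nnegrE.
Qed.

Lemma incr_cont0_ler f x y : incr_cont0 f -> 0 <= x -> x <= y -> f x <= f y.
Proof.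
by move=> fi x0 xy; rewrite (incr_cont0_mono fi) ?nnegrE// (le_trans x0).
Qed.

Lemma incr_cont0_ltr_inv f x y : incr_cont0 f -> 0 <= y ->
  f x < f y -> x < y.
Proof.
move=> fi y0; rewrite !ltNge; apply: contra => yx.
exact: incr_cont0_ler fi y0 yx.
Qed.

Lemma incr_cont0_gt0 f x : incr_cont0 f -> 0 < x -> 0 < f x.
Proof.
by move=> [f0 fi _] x0; rewrite -f0; apply: fi; rewrite ?in_Rplus// ltW.
Qed.

Lemma incr_cont0_eq0 f x : incr_cont0 f -> 0 <= x -> f x = 0 -> x = 0.
Proof.
move=> fi; rewrite le_eqVlt => /predU1P[//|/(incr_cont0_gt0 fi)] + fx0.
by rewrite fx0 ltxx.
Qed.

(** Continuity of f within the half-line is turned into continuity on the whole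
    line, from which measurability and pointwise limits are immediate. *)
Lemma continuous_comp_norm f : incr_cont0 f ->
  continuous (fun u => f `|u|).
Proof.
move=> [_ _ /subspace_continuousP fc] u.
have fu : f y @[y --> within Rplus (nbhs `|u|)] --> f `|u|.
  by apply: fc; apply/set_mem; rewrite in_Rplus.
apply: (cvg_comp (fun v : R => `|v|) f _ fu) => A /= wA.
have nA := @norm_continuous _ R^o u _ wA.
apply: (@filterS _ (nbhs u) _ _ _ _ nA) => y /= Ay; apply: Ay.
by apply/set_mem; rewrite in_Rplus.
Qed.

Lemma convex_on_RplusE f x y a b : convex_on_Rplus f ->
  0 <= x -> 0 <= y -> 0 <= a -> 0 <= b -> a + b = 1 ->
  f (a * x + b * y) <= a * f x + b * f y.
Proof.
move=> cf x0 y0 a0 b0 ab1.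
have a1 : a <= 1 by lra.
have -> : b = 1 - a by lra.
have a01 : Itv.spec (@Itv.num_sem R) (Itv.Real `[0, 1]%Z) a.
  by rewrite /Itv.spec /= /Itv.num_sem/= num_real in_itv/= a0 a1.
have := cf (Itv.mk a01) x y.
by rewrite !in_Rplus => /(_ x0 y0); rewrite !convRE.
Qed.

Lemma convex_on_Rplus_scale f x a : f 0 = 0 -> convex_on_Rplus f ->
  0 <= x -> 0 <= a <= 1 -> f (a * x) <= a * f x.
Proof.
move=> f0 cf x0 /andP[a0 a1].
have b0 : 0 <= 1 - a by lra.
have := convex_on_RplusE cf x0 (lexx 0) a0 b0.
rewrite f0 !mulr0 !addr0; apply; lra.
Qed.

(** By concavity f z >= z / (x + y) * f (x + y) for z = x and for z = y; the two
    weights add up to 1. *)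
Lemma concave_on_Rplus_subadditive f x y : f 0 = 0 -> concave_on_Rplus f ->
  0 <= x -> 0 <= y -> f (x + y) <= f x + f y.
Proof.
move=> f0 cf; rewrite le_eqVlt => /predU1P[<-|x0].
  by rewrite add0r f0 add0r.
move=> y0; have s0 : 0 < x + y by lra.
have part z : 0 <= z <= x + y -> z / (x + y) * f (x + y) <= f z.
  move=> /andP[z0 zs].
  have zs01 : 0 <= z / (x + y) <= 1.
    by rewrite divr_ge0 ?(ltW s0)//= ler_pdivrMr// mul1r.
  have := convex_on_Rplus_scale (f := fun x => - f x) _ cf (ltW s0) zs01.
  by rewrite f0 oppr0 mulrN lerN2 divfK ?gt_eqF//; exact.
have := lerD (part x _) (part y _); rewrite -!mulrDl divff ?gt_eqF// mul1r.
by apply; lra.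
Qed.

(** As psi is subadditive, psi |x - y| satisfies the triangle inequality, so
    the increments telescope; as psi is strictly increasing, psi |x - y| small
    forces |x - y| small.  Hence u is a Cauchy sequence. *)
Lemma cvgn_concave_geometric psi (u : nat -> R) C :
  incr_cont0 psi -> concave_on_Rplus psi -> 0 <= C ->
  (forall n, psi `|u n - u n.+1| <= C / 2 ^+ n.+1) -> cvgn u.
Proof.
move=> psi_incr psi_concave C0 uC; case: (psi_incr) => psi0 _ _.
have p2_gt0 k : 0 < 2 ^+ k :> R by rewrite exprn_gt0.
have tele n k : psi `|u n - u (n + k)%N| <= C / 2 ^+ n - C / 2 ^+ (n + k).
  elim: k => [|k IHk]; first by rewrite addn0 !subrr normr0 psi0.
  have split_norm : `|u n - u (n + k.+1)%N| <=
      `|u n - u (n + k)%N| + `|u (n + k)%N - u (n + k.+1)%N|.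
    exact: ler_distD.
  apply: le_trans (incr_cont0_ler psi_incr (normr_ge0 _) split_norm) _.
  apply: le_trans (concave_on_Rplus_subadditive psi0 psi_concave _ _) _ => //.
  apply: le_trans (lerD IHk _) _; first by rewrite addnS; exact: uC.
  rewrite addnS exprS.
  have -> : C / (2 * 2 ^+ (n + k)) = C / 2 ^+ (n + k) / 2.
    by rewrite mulrAC -mulrA -invfM mulrC.
  lra.
apply/cauchy_cvgP/cauchyP => e e0.
have [N _ CN] : \forall n \near \oo, C / 2 ^+ n < psi e.
  have pe0 := incr_cont0_gt0 psi_incr e0.
  have C2_cvg : C / 2 ^+ n @[n --> \oo] --> 0.
    have := @cvg_geometric R C 2^-1.
    rewrite ger0_norm ?invr_ge0// invf_lt1// ltr1n => /(_ isT).
    by under eq_cvg do rewrite /geometric /= exprVn.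
  by move/cvgr_lt : C2_cvg; apply.
exists (u N); exists N => // m /= /subnKC <-.
rewrite /ball /=.
apply: (incr_cont0_ltr_inv psi_incr (ltW e0)).
apply: le_lt_trans (tele N _) _; apply: le_lt_trans (CN N (leqnn N)).
by rewrite gerBl divr_ge0// ltW.
Qed.

End halfline_functions.

(** * The modular *)

Section modular_theory.
Context {d : measure_display} {X : measurableType d} {R : realType}.
Variable mu : {measure set X -> \bar R}.
Variables phi psi : R -> R.
Hypothesis phi_incr : incr_cont0 phi.
Hypothesis psi_incr : incr_cont0 psi.
Hypothesis phi_convex : convex_on_Rplus phi.
Hypothesis psi_concave : concave_on_Rplus psi.

Implicit Types (f g h : X -> R) (s t u v : R).

(** The integrand of the modular, as a function of the value u = h x. *)
Let kernel t u : R := phi (t^-1 * psi `|u|).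

Let arg_ge0 t u : 0 < t -> 0 <= t^-1 * psi `|u|.
Proof.
by move=> t0; rewrite mulr_ge0 ?invr_ge0 ?(ltW t0)// (incr_cont0_ge0 psi_incr).
Qed.

Let kernel_ge0 t u : 0 < t -> 0 <= kernel t u.
Proof. by move=> t0; rewrite (incr_cont0_ge0 phi_incr)// arg_ge0. Qed.

Let kernel_continuous t : 0 < t -> continuous (kernel t).
Proof.
move=> t0 u.
have -> : kernel t = (fun v => phi `|v|) \o (fun u => t^-1 * psi `|u|).
  by apply/funext => w; rewrite /kernel /= (ger0_norm (arg_ge0 _ t0)).
apply: continuous_comp; last exact: continuous_comp_norm.
apply: cvgM; first exact: cvg_cst.
exact: continuous_comp_norm.
Qed.

Let measurable_kernel t h : 0 < t -> measurable_fun setT h ->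
  measurable_fun setT (EFin \o (kernel t \o h)).
Proof.
move=> t0 mh; apply/measurable_EFinP.
apply: (measurableT_comp (f := kernel t)) => //.
by apply: continuous_measurable_fun; exact: kernel_continuous.
Qed.

Let kernel_scale s t u : 0 < s <= t -> kernel t u <= s / t * kernel s u.
Proof.
move=> /andP[s0 st]; have t0 := lt_le_trans s0 st.
have -> : kernel t u = phi (s / t * (s^-1 * psi `|u|)).
  by rewrite /kernel; congr phi; field; lra.
case: phi_incr => phi0 _ _.
apply: convex_on_Rplus_scale => //; first exact: arg_ge0.
by rewrite divr_ge0 ?(ltW s0) ?(ltW t0)//= ler_pdivrMr// mul1r.
Qed.

(** (psi |u| + psi |v|) / (s + t) is the convex combination of psi |u| / s and
    psi |v| / t with weights s / (s + t) and t / (s + t). *)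
Let kernel_triangle s t u v : 0 < s -> 0 < t ->
  kernel (s + t) (u + v) <=
    s / (s + t) * kernel s u + t / (s + t) * kernel t v.
Proof.
move=> s0 t0; have st0 : 0 < s + t by lra.
case: psi_incr => psi0 _ _.
apply: le_trans
  (convex_on_RplusE phi_convex (arg_ge0 u s0) (arg_ge0 v t0) _ _ _).
- apply: (incr_cont0_ler phi_incr (arg_ge0 _ st0)).
  have -> : s / (s + t) * (s^-1 * psi `|u|) + t / (s + t) * (t^-1 * psi `|v|) =
      (s + t)^-1 * (psi `|u| + psi `|v|) by field; lra.
  rewrite ler_pM2l ?invr_gt0//.
  apply: le_trans (concave_on_Rplus_subadditive psi0 psi_concave _ _) => //.
  by apply: incr_cont0_ler => //; exact: ler_normD.
- by rewrite divr_ge0// ltW.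
- by rewrite divr_ge0// ltW.
- by field; lra.
Qed.

Local Notation Modular := (modular mu phi psi).

Lemma modular_ge0 t h : 0 < t -> (0 <= Modular t h)%E.
Proof.
by move=> t0; apply: integral_ge0 => x _; rewrite lee_fin kernel_ge0.
Qed.

Lemma modular_norm t f g : (forall x, `|f x| = `|g x|) ->
  Modular t f = Modular t g.
Proof. by move=> fg; apply: eq_integral => x _; rewrite fg. Qed.

Lemma modular_ae_eq t f g : 0 < t ->
  measurable_fun setT f -> measurable_fun setT g ->
  (\forall x \ae mu, f x = g x) -> Modular t f = Modular t g.
Proof.
move=> t0 mf mg fg; apply: ge0_ae_eq_integral => //.
- exact: measurable_kernel.
- exact: measurable_kernel.
- by move=> x _; rewrite lee_fin kernel_ge0.
- by move=> x _; rewrite lee_fin kernel_ge0.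
- by apply: filterS fg => x -> _.
Qed.

(** The factor s / t comes from the convexity of phi; for small s it turns a
    bound at most 1 into a small one. *)
Lemma modular_scale s t h : 0 < s <= t -> measurable_fun setT h ->
  (Modular t h <= (s / t)%:E * Modular s h)%E.
Proof.
move=> st mh; have /andP[s0 s_le_t] := st; have t0 := lt_le_trans s0 s_le_t.
rewrite -ge0_integralZl_EFin//; last 3 first.
- by move=> x _; rewrite lee_fin kernel_ge0.
- exact: measurable_kernel.
- by rewrite divr_ge0// ltW.
apply: ge0_le_integral => //.
- by move=> x _; rewrite lee_fin kernel_ge0.
- exact: measurable_kernel.
- by apply: measurable_funeM; exact: measurable_kernel.
- by move=> x _; rewrite -EFinM lee_fin kernel_scale.
Qed.

Lemma modular_triangle s t f g : 0 < s -> 0 < t ->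
  measurable_fun setT f -> measurable_fun setT g ->
  (Modular (s + t) (fun x => f x + g x)%R <=
   (s / (s + t))%:E * Modular s f + (t / (s + t))%:E * Modular t g)%E.
Proof.
move=> s0 t0 mf mg; have st0 : 0 < s + t by lra.
have ws : 0 <= s / (s + t) by rewrite divr_ge0// ltW.
have wt : 0 <= t / (s + t) by rewrite divr_ge0// ltW.
have fs x : [set: X] x -> (0 <= (kernel s (f x))%:E)%E.
  by move=> _; rewrite lee_fin kernel_ge0.
have gt x : [set: X] x -> (0 <= (kernel t (g x))%:E)%E.
  by move=> _; rewrite lee_fin kernel_ge0.
have mfs : measurable_fun setT (EFin \o (kernel s \o f)).
  exact: measurable_kernel.
have mgt : measurable_fun setT (EFin \o (kernel t \o g)).
  exact: measurable_kernel.
rewrite -!ge0_integralZl_EFin//.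
rewrite -ge0_integralD//; last 4 first.
- by move=> x _; apply: mule_ge0; [rewrite lee_fin|exact: fs].
- exact: measurable_funeM.
- by move=> x _; apply: mule_ge0; [rewrite lee_fin|exact: gt].
- exact: measurable_funeM.
apply: ge0_le_integral => //.
- by move=> x _; rewrite lee_fin kernel_ge0.
- by apply: measurable_kernel => //; exact: measurable_funD.
- by apply: emeasurable_funD; exact: measurable_funeM.
- by move=> x _; rewrite -!EFinM -EFinD lee_fin kernel_triangle.
Qed.

(** Fatou's lemma applies because the integrands are nonnegative and, phi and
    psi being continuous, converge wherever h_ n x does. *)
Lemma modular_fatou t (h_ : nat -> X -> R) h (C : \bar R) : 0 < t ->
  (forall n, measurable_fun setT (h_ n)) -> measurable_fun setT h ->
  (\forall x \ae mu, h_ n x @[n --> \oo] --> h x) ->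
  (\forall n \near \oo, (Modular t (h_ n) <= C)%E) ->
  (Modular t h <= C)%E.
Proof.
move=> t0 mh_ mh h_h hC.
have mkh_ n : measurable_fun setT (EFin \o (kernel t \o h_ n)).
  exact: measurable_kernel.
have kh_ge0 n x : setT x -> (0 <= (kernel t (h_ n x))%:E)%E.
  by move=> _; rewrite lee_fin kernel_ge0.
have einf_ge0 x : (0 <= limn_einf (fun n => (kernel t (h_ n x))%:E))%E.
  rewrite limn_einf_lim; apply: lime_ge; first exact: is_cvg_einfs.
  apply: nearW => m; apply: le_ereal_inf_tmp => _ [k _ <-].
  by rewrite lee_fin kernel_ge0.
have meinf : measurable_fun setT
    (fun x => limn_einf (fun n => (kernel t (h_ n x))%:E)).
  apply: measurableT_comp => //; apply: measurable_fun_limn_esup => n.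
  by apply: measurableT_comp => //; exact: mkh_.
rewrite /modular (ge0_ae_eq_integral _ _ meinf)//; first last.
- apply: filterS h_h => x /= cvgx _; apply/esym.
  have /cvg_limn_einf_sup[-> //] :
      (kernel t (h_ n x))%:E @[n --> \oo] --> (kernel t (h x))%:E.
  apply: cvg_EFin; first exact: nearW.
  by apply: (cvg_comp _ _ cvgx); exact: kernel_continuous.
- by move=> x _; rewrite lee_fin kernel_ge0.
- exact: measurable_kernel.
apply: le_trans (fatou mu measurableT mkh_ kh_ge0) _.
rewrite limn_einf_lim; apply: lime_le; first exact: is_cvg_einfs.
case: hC => N _ hC; apply: nearW => m.
apply: le_trans (hC (maxn N m) (leq_maxl _ _)).
by apply: ereal_inf_lbound; exists (maxn N m) => //=; exact: leq_maxr.
Qed.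

(** [modular_scale] gives Modular 1 h <= s * Modular s h <= s for all s <= 1,
    so the integrand at t = 1 vanishes almost everywhere. *)
Lemma modular_le1_ae0 h : measurable_fun setT h ->
  (forall t, 0 < t -> (Modular t h <= 1)%E) -> \forall x \ae mu, h x = 0.
Proof.
move=> mh h1.
have M0 : Modular 1 h = 0%E.
  apply/eqP; rewrite eq_le modular_ge0// andbT.
  apply/lee_addgt0Pr => e e0; rewrite add0e.
  pose s : R := Num.min e 1.
  have s0 : 0 < s by rewrite lt_min e0 ltr01.
  have s1 : 0 < s <= 1 by rewrite s0 ge_min lexx orbT.
  have /le_trans := modular_scale s1 mh; apply.
  rewrite divr1; apply: (@le_trans _ _ (s%:E * 1)%E).
    by apply: lee_wpmul2l; [rewrite lee_fin ltW|exact: h1].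
  by rewrite mule1 lee_fin ge_min lexx.
have mk : measurable_fun setT (EFin \o (kernel 1 \o h)).
  exact: measurable_kernel.
have : (\int[mu]_x `|(EFin \o (kernel 1 \o h)) x| = 0)%E.
  rewrite -[RHS]M0; apply: eq_integral => x _.
  by rewrite gee0_abs// lee_fin kernel_ge0.
move=> /(ae_eq_integral_abs mu measurableT mk); apply: filterS => x /(_ I) [].
rewrite /kernel invr1 mul1r => /(incr_cont0_eq0 phi_incr).
move=> /(_ (incr_cont0_ge0 psi_incr (normr_ge0 _))).
by move=> /(incr_cont0_eq0 psi_incr (normr_ge0 _))/normr0_eq0.
Qed.

(** With M the given modular, enlarging t by the factor 1 + M makes the modular
    at most M / (1 + M). *)
Lemma modular_lty_le1 t h : 0 < t -> measurable_fun setT h ->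
  (Modular t h < +oo)%E -> exists2 s, 0 < s & (Modular s h <= 1)%E.
Proof.
move=> t0 mh hfin; have M_ge0 := modular_ge0 h t0.
have Mfin : Modular t h \is a fin_num by rewrite ge0_fin_numE.
set M := fine (Modular t h); have M0 : 0 <= M by rewrite fine_ge0.
have tM : 0 < t <= t * (1 + M) by rewrite t0 ler_pMr//; lra.
have s0 : 0 < t * (1 + M) by rewrite mulr_gt0//; lra.
exists (t * (1 + M)) => //.
have /le_trans := modular_scale tM mh; apply.
rewrite -(fineK Mfin) -/M -EFinM lee_fin.
have -> : t / (t * (1 + M)) * M = M / (1 + M) by field; lra.
by rewrite ler_pdivrMr; lra.
Qed.

Lemma modular_add_le1 s t f g : 0 < s -> 0 < t ->
  measurable_fun setT f -> measurable_fun setT g ->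
  (Modular s f <= 1)%E -> (Modular t g <= 1)%E ->
  (Modular (s + t) (fun x => f x + g x)%R <= 1)%E.
Proof.
move=> s0 t0 mf mg f1 g1; have st0 : 0 < s + t by lra.
apply: le_trans (modular_triangle s0 t0 mf mg) _.
have -> : 1%E = ((s / (s + t))%:E * 1 + (t / (s + t))%:E * 1)%E :> \bar R.
  by rewrite !mule1 -EFinD -mulrDl divff ?gt_eqF.
by apply: leeD; apply: lee_wpmul2l; rewrite // lee_fin divr_ge0// ltW.
Qed.

(** Linear growth of phi: phi y >= y * phi 1 for y >= 1, so a bound on phi y
    bounds y. *)
Let psi_le_of_kernel t u M : 0 < t -> kernel t u <= M ->
  psi `|u| <= t * (1 + M / phi 1).
Proof.
move=> t0 kM; have phi1 := incr_cont0_gt0 phi_incr (ltr01 : 0 < 1 :> R).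
set y := t^-1 * psi `|u|.
have y0 : 0 <= y.
  by rewrite mulr_ge0 ?invr_ge0 ?(ltW t0)// (incr_cont0_ge0 psi_incr).
have -> : psi `|u| = t * y by rewrite mulVKf// gt_eqF.
have M0 : 0 <= M := le_trans (incr_cont0_ge0 phi_incr y0) kM.
have M1 : 0 <= M / phi 1 by rewrite divr_ge0// ltW.
rewrite ler_pM2l//; have [y1|y1] := leP y 1; first lra.
suff : y <= M / phi 1 by lra.
rewrite ler_pdivlMr//; case: (phi_incr) => phi0 _ _.
have yi01 : 0 <= y^-1 <= 1.
  by rewrite invr_ge0 y0 /= invf_le1 ?(ltW y1)// (lt_trans ltr01).
have := convex_on_Rplus_scale phi0 phi_convex y0 yi01.
rewrite mulVf ?gt_eqF//; last lra.
rewrite mulrC ler_pdivlMr; last lra.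
by rewrite mulrC => /le_trans; exact.
Qed.

(** The scale 4^-(n+1) is split as w n * w n with w n = 2^-(n+1): one factor
    makes the integrals of the kernels at scale w n summable, and the other is
    left as a geometric bound on psi |u_ n x - u_ n.+1 x|. *)
Lemma modular_cvg_ae (u_ : nat -> X -> R) :
  (forall n, measurable_fun setT (u_ n)) ->
  (forall n, (Modular (4^-1 ^+ n.+1) (fun x => u_ n x - u_ n.+1 x)%R <= 1)%E) ->
  \forall x \ae mu, cvgn (u_ ^~ x).
Proof.
move=> mu_ u1.
pose w n : R := 2^-1 ^+ n.+1.
have w0 n : 0 < w n by rewrite exprn_gt0.
pose k_ n := EFin \o (kernel (w n) \o (fun x => u_ n x - u_ n.+1 x)).
have mk n : measurable_fun setT (k_ n).
  by apply: measurable_kernel => //; exact: measurable_funB.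
have k0 n x : [set: X] x -> (0 <= k_ n x)%E.
  by move=> _; rewrite lee_fin kernel_ge0.
have ik n : (\int[mu]_x k_ n x <= (1 / (2 ^ n.+1)%:R)%:E)%E.
  have w4 : 4^-1 ^+ n.+1 = w n * w n :> R.
    by rewrite /w -exprMn; congr (_ ^+ _); lra.
  have st : 0 < (4^-1 ^+ n.+1 : R) <= w n.
    apply/andP; split; first by rewrite w4 mulr_gt0.
    by rewrite w4 ger_pMr// exprn_ile1// invf_le1// ler1n.
  have mD : measurable_fun setT (fun x => u_ n x - u_ n.+1 x).
    exact: measurable_funB.
  have /le_trans := modular_scale st mD; apply.
  have -> : 4^-1 ^+ n.+1 / w n = w n by rewrite w4 mulfK ?gt_eqF.
  apply: le_trans (lee_wpmul2l _ (u1 n)) _; first by rewrite lee_fin ltW.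
  by rewrite mule1 lee_fin /w exprVn natrX div1r.
pose S x := (\sum_(n <oo) k_ n x)%E.
have mS : measurable_fun setT S.
  apply: (@ge0_emeasurable_sum _ _ _ _ _ xpredT) => // n x Dx _.
  exact: k0.
have iS : (\int[mu]_x S x <= 1)%E.
  rewrite integral_nneseries//.
  apply: le_trans (epsilon_trick0 xpredT ler01).
  apply: lee_nneseries => [n _ _|n _]; last exact: ik.
  by apply: integral_ge0 => x; exact: k0.
have S0 x : (0 <= S x)%E by apply: nneseries_ge0 => n _ _; exact: k0.
have Sint : mu.-integrable setT S.
  apply/integrableP; split=> //.
  under eq_integral do rewrite gee0_abs//.
  by apply: le_lt_trans iS _; rewrite ltry.
(* A finite sum S x bounds each of its terms k_ n x. *)
have := integrable_ae measurableT Sint; apply: filterS => x /(_ I) Sfin.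
have C0 : 0 <= 1 + fine (S x) / phi 1.
  by rewrite addr_ge0// divr_ge0// ?fine_ge0// (incr_cont0_ge0 phi_incr).
apply: (cvgn_concave_geometric psi_incr psi_concave C0) => n.
rewrite mulrC -exprVn; apply: psi_le_of_kernel; first exact: w0.
rewrite -lee_fin fineK//; change (k_ n x <= S x)%E.
have part_le : (\sum_(0 <= i < n.+1) k_ i x <= S x)%E.
  by apply: nneseries_lim_ge => i _ _; exact: k0.
apply: le_trans part_le; rewrite big_nat_recr//= leeDr//.
by apply: sume_ge0 => i _; exact: k0.
Qed.

Lemma modular_complete (u_ : nat -> X -> R) :
  (forall n, measurable_fun setT (u_ n)) ->
  (forall n m, (n <= m)%N ->
     (Modular (4^-1 ^+ n.+1) (fun x => u_ n x - u_ m x)%R <= 1)%E) ->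
  exists2 v : X -> R, measurable_fun setT v &
    forall n, (Modular (4^-1 ^+ n.+1) (fun x => u_ n x - v x)%R <= 1)%E.
Proof.
move=> mu_ uC.
have u_cvg : \forall x \ae mu, cvgn (u_ ^~ x).
  by apply: modular_cvg_ae => // n; exact: uC.
(* The upper limit is measurable everywhere and is the limit where that
   exists, so no exceptional null set has to be removed. *)
pose v x := fine (limn_esup (fun n => (u_ n x)%:E)).
have mv : measurable_fun setT v.
  apply: measurableT_comp => //.
  by apply: measurable_fun_limn_esup => n; exact/measurable_EFinP.
exists v => // n.
apply: (@modular_fatou _ (fun m x => u_ n x - u_ m x)) => //.
- by move=> m; exact: measurable_funB.
- exact: measurable_funB.
- apply: filterS u_cvg => x ux; apply: cvgB; first exact: cvg_cst.
  have -> : v x = limn (u_ ^~ x).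
    have cE : cvgn (EFin \o (u_ ^~ x)).
      apply/cvg_ex; exists (limn (u_ ^~ x))%:E.
      by apply: cvg_EFin => //; exact: nearW.
    by rewrite /v (is_cvg_limn_esupE cE) EFin_lim.
  exact: ux.
- by exists n => // m; exact: uC.
Qed.

(** * The Luxemburg functional *)

(** Unfolds to [dtheta] when h is a difference of representatives. *)
Definition luxemburg h : \bar R :=
  ereal_inf [set t%:E | t in [set t : R | 0 < t /\ (Modular t h <= 1)%E]].

Lemma luxemburg_ge0 h : (0 <= luxemburg h)%E.
Proof.
by apply: le_ereal_inf_tmp => _ [t [t0 _] <-]; rewrite lee_fin ltW.
Qed.

Lemma luxemburg_le t h : 0 < t -> (Modular t h <= 1)%E ->
  (luxemburg h <= t%:E)%E.
Proof. by move=> t0 h1; apply: ereal_inf_lbound; exists t. Qed.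

(** Antitonicity of the modular in t turns an infimum below t into a bound at t
    itself. *)
Lemma luxemburg_lt t h : measurable_fun setT h -> (luxemburg h < t%:E)%E ->
  0 < t /\ (Modular t h <= 1)%E.
Proof.
move=> mh /ereal_inf_lt[_ [s [s0 h1] <-]]; rewrite lte_fin => st.
have t0 := lt_trans s0 st; split => //.
have s_t : 0 < s <= t by rewrite s0 ltW.
have /le_trans := modular_scale s_t mh; apply.
apply: (@le_trans _ _ ((s / t)%:E * 1)%E).
  by apply: lee_wpmul2l; [rewrite lee_fin divr_ge0 ?ltW|].
by rewrite mule1 lee_fin ler_pdivrMr// mul1r ltW.
Qed.

Lemma luxemburg_norm f g : (forall x, `|f x| = `|g x|) ->
  luxemburg f = luxemburg g.
Proof.
move=> fg; rewrite /luxemburg.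
by under eq_fun => t do rewrite (modular_norm t fg).
Qed.

Lemma luxemburg_ae_eq f g :
  measurable_fun setT f -> measurable_fun setT g ->
  (\forall x \ae mu, f x = g x) -> luxemburg f = luxemburg g.
Proof.
move=> mf mg fg; rewrite /luxemburg; congr (ereal_inf (_ @` _)).
by apply/seteqP; split=> t /= [t0]; rewrite (modular_ae_eq t0 mf mg fg).
Qed.

(** Identifies L^theta as the set of classes of finite Luxemburg norm, which
    makes it closed under differences by the triangle inequality. *)
Lemma luxemburg_ltyP h : measurable_fun setT h ->
  (exists2 t, 0 < t & (Modular t h < +oo)%E) <-> (luxemburg h < +oo)%E.
Proof.
move=> mh; split=> [[t t0 hfin]|/ereal_inf_lt[_ [t [t0 h1] <-]] _].
  have [s s0 h1] := modular_lty_le1 t0 mh hfin.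
  by apply: le_lt_trans (luxemburg_le s0 h1) _; rewrite ltry.
by exists t => //; apply: le_lt_trans h1 _; rewrite ltry.
Qed.

Lemma luxemburg0 : luxemburg (fun=> 0) = 0%E.
Proof.
apply/eqP; rewrite eq_le luxemburg_ge0 andbT.
apply/lee_addgt0Pr => e e0; rewrite add0e; apply: luxemburg_le => //.
rewrite (_ : Modular e _ = 0%E)//; apply: integral0_eq => x _.
case: phi_incr psi_incr => phi0 _ _ [psi0 _ _].
by rewrite normr0 psi0 mulr0 phi0.
Qed.

Lemma luxemburg_eq0 h : measurable_fun setT h -> luxemburg h = 0%E ->
  \forall x \ae mu, h x = 0.
Proof.
move=> mh h0; apply: modular_le1_ae0 => // t t0.
by have [] := @luxemburg_lt t h mh; rewrite ?h0 ?lte_fin.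
Qed.

Lemma luxemburg_triangle f g :
  measurable_fun setT f -> measurable_fun setT g ->
  (luxemburg (fun x => f x + g x)%R <= luxemburg f + luxemburg g)%E.
Proof.
move=> mf mg.
have lower h : luxemburg h != -oo%E.
  by rewrite gt_eqF// (lt_le_trans _ (luxemburg_ge0 h)).
have [->|fy] := eqVneq (luxemburg f) +oo%E; first by rewrite addye// leey.
have [->|gy] := eqVneq (luxemburg g) +oo%E; first by rewrite addey// leey.
have /fineK fE : luxemburg f \is a fin_num by rewrite fin_numE lower.
have /fineK gE : luxemburg g \is a fin_num by rewrite fin_numE lower.
rewrite -fE -gE; set a := fine (luxemburg f); set b := fine (luxemburg g).
apply/lee_addgt0Pr => e e0; have e2 : 0 < e / 2 by rewrite divr_gt0.
have [s0 f1] : 0 < a + e / 2 /\ (Modular (a + e / 2) f <= 1)%E.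
  by apply: luxemburg_lt; rewrite // -fE lte_fin ltrDl.
have [t0 g1] : 0 < b + e / 2 /\ (Modular (b + e / 2) g <= 1)%E.
  by apply: luxemburg_lt; rewrite // -gE lte_fin ltrDl.
rewrite -!EFinD (_ : a + b + e = (a + e / 2) + (b + e / 2)); last lra.
apply: luxemburg_le; first exact: addr_gt0.
exact: modular_add_le1.
Qed.

Lemma luxemburg_complete (u_ : nat -> X -> R) :
  (forall n, measurable_fun setT (u_ n)) ->
  (forall n m, (n <= m)%N ->
     (luxemburg (fun x => u_ n x - u_ m x)%R < (4^-1 ^+ n.+1)%:E)%E) ->
  exists2 v : X -> R, measurable_fun setT v &
    forall n, (luxemburg (fun x => u_ n x - v x)%R <= (4^-1 ^+ n.+1)%:E)%E.
Proof.
move=> mu_ uC.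
have [n m nm|v mv uv] := @modular_complete u_ mu_.
  by have [] := luxemburg_lt (measurable_funB (mu_ n) (mu_ m)) (uC n m nm).
by exists v => // n; apply: luxemburg_le => //; rewrite exprn_gt0.
Qed.

End modular_theory.

(** * Metrics given by a distance function *)

(** Completeness for filters follows from convergence of the sequences that are
    Cauchy at the fixed geometric rate 4^-(n+1).  Given a Cauchy filter, choose
    balls of radius 4^-(n+1) / 2 belonging to it; any two of them meet, so their
    centers form such a sequence, and its limit is the limit of the filter. *)
Lemma complete_metric_of_dist (R : realType) (L : Type)
    (D : L -> L -> R) :
  (forall x, D x x = 0) -> (forall x y, D x y = 0 -> x = y) ->
  (forall x y, D x y = D y x) -> (forall y x z, D x z <= D x y + D y z) ->
  (forall u : nat -> L,
    (forall n m, (n <= m)%N -> D (u n) (u m) < 4^-1 ^+ n.+1) ->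
    exists v, forall n, D (u n) v <= 4^-1 ^+ n.+1) ->
  is_complete_metric_space (fun x y => (D x y)%:E).
Proof.
move=> Dxx D0 Dsym Dtri Dcomplete.
pose eqL := gen_eqMixin L; pose choiceL := gen_choiceMixin L.
pose M : metricType R := HB.pack L eqL choiceL
  (@isMetric.Axioms_ R L choiceL eqL D Dxx D0 Dsym Dtri).
exists (Metric.class M); split => //.
rewrite -/M => F FF /cauchyP Fc.
pose r n : R := 4^-1 ^+ n.+1.
have r0 n : 0 < r n by rewrite exprn_gt0.
have rS n m : (n <= m)%N -> r m <= r n.
  by move=> nm; rewrite /r ler_wiXn2l// invf_le1// ler1n.
have /choice[u uF] : forall n, exists x : M, F (ball x (r n / 2)).
  by move=> n; apply: Fc; rewrite divr_gt0.
have ballE (x y : M) (e : R) : ball x e y = (D x y < e) :> Prop.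
  by rewrite ballEmdist.
have [v uv] : exists v, forall n, D (u n) v <= r n.
  apply: Dcomplete => n m nm.
  have [z []] := filter_ex (filterI (uF n) (uF m)).
  rewrite !ballE (Dsym (u m)) => unz umz.
  have := Dtri z (u n) (u m); have := rS _ _ nm; rewrite -/(r n); lra.
exists v; apply/cvg_ballP => e e0.
have [N _ rN] : \forall n \near \oo, r n < e / 2.
  have r_cvg : r n @[n --> \oo] --> 0.
    have /cvg_geometric : `|4^-1 : R| < 1.
      by rewrite ger0_norm ?invr_ge0// invf_lt1// ltr1n.
    by move=> /(_ 4^-1); under eq_cvg do rewrite /geometric /= -exprS.
  by move/cvgr_lt : r_cvg; apply; rewrite divr_gt0.
apply: filterS (uF N) => x; rewrite !ballE => uNx.
have := rN N (leqnn N); have := uv N; rewrite (Dsym (u N) v).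
have := Dtri (u N) v x; have := r0 N; lra.
Qed.

(** * Classes of measurable functions *)

Lemma class_of_measurable {d : measure_display} {X : measurableType d}
    {R : realType} (mu : {measure set X -> \bar R}) (v : X -> R) :
  measurable_fun setT v ->
  exists g : {mfun_ mu, X >-> measurableTypeR R}, \forall x \ae mu, v x = g x.
Proof.
move=> mv.
pose V : {mfun X >-> measurableTypeR R} :=
  HB.pack v (@isMeasurableFun.Build _ _ X (measurableTypeR R) v mv).
exists (\pi_{mfun_ mu, X >-> measurableTypeR R}%qT V).
have /eqmodP/asboolP := reprK (\pi_{mfun_ mu, X >-> measurableTypeR R}%qT V).
by apply: filterS => x /(_ I) Vx; exact/esym/Vx.
Qed.

Lemma class_eq {d : measure_display} {X : measurableType d}
    {R : realType} (mu : {measure set X -> \bar R})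
    (f g : {mfun_ mu, X >-> measurableTypeR R}) :
  (\forall x \ae mu, f x = g x) -> f = g.
Proof.
move=> fg; rewrite -[f]reprK -[g]reprK; apply/eqmodP/asboolP.
by apply: filterS fg => x + _.
Qed.

Lemma class_measurable {d : measure_display} {X : measurableType d}
    {R : realType} (mu : {measure set X -> \bar R})
    (f : {mfun_ mu, X >-> measurableTypeR R}) :
  measurable_fun setT (f : X -> R).
Proof. exact: (@measurable_funPT _ _ _ _ (repr f)). Qed.

Unset Implicit Arguments.

Theorem theorem2p1 (R : realType) (dX : measure_display)
  (X : measurableType dX) (mu : {measure set X -> \bar R})
  (mu_sfin : sigma_finite [set: X] mu)
  (theta phi psi : R -> R)
  (theta_incr : incr_cont0 theta)
  (theta_ccc : ccc_function theta)
  (phi_psi_min : minimal_convex_concave_fact theta phi psi) :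
  is_complete_metric_space
    (fun f g : Ltheta mu phi psi => dtheta mu phi psi (val f) (val g)).
Proof.
case: phi_psi_min => -[phi_incr psi_incr phi_convex psi_concave _] _.
pose L := Ltheta mu phi psi.
pose N h := luxemburg mu phi psi h.
pose delta (f g : L) (x : X) : R := (val f x : R) - (val g x : R).
have mval (f : L) : measurable_fun setT (val f : X -> R).
  exact: class_measurable.
have mdelta (f g : L) : measurable_fun setT (delta f g).
  exact: measurable_funB.
have triangle (h k : X -> R) : measurable_fun setT h -> measurable_fun setT k ->
    (N (fun x => h x + k x)%R <= N h + N k)%E.
  exact: luxemburg_triangle.
have N_lty (f : L) : (N (val f) < +oo)%E.
  by apply/luxemburg_ltyP => //; exact: set_mem (valP f).
have Nfin (f g : L) : N (delta f g) \is a fin_num.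
  rewrite ge0_fin_numE; last exact: luxemburg_ge0.
  have Ng : N (fun x => - (val g x : R)) = N (val g).
    by apply: luxemburg_norm => x; rewrite normrN.
  apply: le_lt_trans (triangle _ _ (mval f) _) _; first exact: measurable_funN.
  by rewrite Ng lte_add_pinfty.
pose D f g := fine (N (delta f g)).
have DE f g : N (delta f g) = (D f g)%:E by rewrite fineK.
have -> : (fun f g : L => dtheta mu phi psi (val f) (val g)) =
          (fun f g => (D f g)%:E).
  by apply/funext => f; apply/funext => g; rewrite -DE.
apply: complete_metric_of_dist.
- move=> f; rewrite /D (_ : delta f f = fun=> 0) ?[N _]luxemburg0//.
  by apply/funext => x; rewrite /delta subrr.
- move=> f g Dfg0; apply/val_inj/class_eq.
  have Nfg0 : N (delta f g) = 0%E by rewrite DE Dfg0.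
  have := luxemburg_eq0 phi_incr psi_incr phi_convex (mdelta f g) Nfg0.
  by apply: filterS => x /subr0_eq.
- by move=> f g; congr fine; apply: luxemburg_norm => x; rewrite /delta distrC.
- move=> g f h; rewrite -lee_fin EFinD -!DE.
  have -> : delta f h = (fun x => delta f g x + delta g h x).
    by apply/funext => x; rewrite /delta subrKA.
  exact: triangle.
- move=> u uC.
  have uN n m : (n <= m)%N ->
      (N (delta (u n) (u m)) < (4^-1 ^+ n.+1)%:E)%E.
    by move=> nm; rewrite DE lte_fin uC.
  have [v mv uv] := luxemburg_complete phi_incr psi_incr phi_convex psi_concave
    (fun n => mval (u n)) uN.
  have [g vg] := class_of_measurable mu mv; have mg := class_measurable g.
  have NE (h : X -> R) : measurable_fun setT h ->
      N (fun x => h x - (g x : R)) = N (fun x => h x - v x).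
    move=> mh; apply: luxemburg_ae_eq => //; try exact: measurable_funB.
    by apply: filterS vg => x ->.
  (* g = u 0 + (g - u 0) with g - u 0 at finite distance from 0. *)
  have gL : g \in L.
    apply/mem_set/(luxemburg_ltyP mu phi_incr psi_incr phi_convex mg).
    rewrite -/(N _).
    have -> : (g : X -> R) = (fun x => (val (u 0%N) x : R) +
                              ((g x : R) - (val (u 0%N) x : R))).
      by apply/funext => x; rewrite addrC subrK.
    apply: le_lt_trans (triangle _ _ _ _) _ => //; first exact: measurable_funB.
    rewrite lte_add_pinfty//.
    have -> : N (fun x => (g x : R) - (val (u 0%N) x : R)) =
              N (fun x => (val (u 0%N) x : R) - (g x : R)).
      by apply: luxemburg_norm => x; rewrite distrC.
    by rewrite NE//; apply: le_lt_trans (uv 0%N) _; rewrite ltry.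
  exists (exist _ g gL) => n; rewrite -lee_fin -DE.
  by rewrite [N _]NE.
Qed.
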